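(* Let $(X,d)$ be a metric space, let $p\in X$, let $D=X\setminus\{p\}$, and let $x\in D$. Then for every $t\in[0,\log 3)$, $$B_d(x,r)\subseteq B_{\tau_p}(x,t)\subseteq B_d(x,R),$$ where $$r=\frac{e^t-1}{e^t+1}\,d(x,p)\quad\text{and}\quad R=\frac{e^t-1}{3-e^t}\,d(x,p).$$ Moreover, $R/r\to 1$ as $t\to 0$.
   Context: For a metric space $(X,d)$ and $p\in X$, the scale-invariant Cassinian metric on $X\setminus\{p\}$ is $$\tau_p(x,y)=\log\left(1+2\frac{d(x,y)}{\sqrt{d(x,p)\,d(y,p)}}\right),\quad x,y\in X\setminus\{p\}.$$ Balls are open: $B_d(x,r)=\{y\in X: d(x,y)<r\}$ and $B_{\tau_p}(x,t)=\{y\in X\setminus\{p\}:\tau_p(x,y)<t\}$. The limit $t\to0$ is over $t>0$. *)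

(* Defs.v *)
From HB Require Import structures.
From mathcomp Require Import all_boot all_order all_algebra.
From mathcomp Require Import all_classical all_reals all_analysis.

Set Implicit Arguments.
Unset Strict Implicit.
Unset Printing Implicit Defensive.

Import Order.TTheory GRing.Theory Num.Theory.
Import numFieldNormedType.Exports.

Local Open Scope classical_set_scope.
Local Open Scope ring_scope.

(* The scale-invariant Cassinian metric is a metric on X \ {p} only; tau is
   total on X, and its values at p (where the denominator vanishes and division
   returns 0) carry no meaning, so tau_ball excludes p explicitly. *)
Definition tau (R : realType) (X : metricType R) (p x y : X) : R :=
  ln (1 + 2 * (mdist x y / Num.sqrt (mdist x p * mdist y p))).

Definition tau_ball (R : realType) (X : metricType R) (p x : X) (t : R) :
    set X :=
  [set y | y != p /\ tau p x y < t].

Definition inner_radius (R : realType) (X : metricType R) (p x : X) (t : R) :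
    R :=
  (expR t - 1) / (expR t + 1) * mdist x p.

Definition outer_radius (R : realType) (X : metricType R) (p x : X) (t : R) :
    R :=
  (expR t - 1) / (3 - expR t) * mdist x p.

(* Main.v *)
Require Import Defs.
From HB Require Import structures.
From mathcomp Require Import all_boot all_order all_algebra.
From mathcomp Require Import all_classical all_reals all_analysis.
From mathcomp Require Import ring lra.

Set Implicit Arguments.
Unset Strict Implicit.
Unset Printing Implicit Defensive.

Import Order.TTheory GRing.Theory Num.Theory.
Import numFieldNormedType.Exports.

Local Open Scope classical_set_scope.
Local Open Scope ring_scope.

(** Write a = d(x,p), b = d(y,p), s = d(x,y) and E = e^t. For y <> p,
    tau_p(x,y) < t means 2 s < (E - 1) sqrt(a b). If s < r, then
    b >= a - s > 2 a / (E + 1), hence sqrt(a b) > 2 a / (E + 1) because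
    2 / (E + 1) <= 1, and multiplying by (E - 1) / 2 gives
    (E - 1) sqrt(a b) / 2 >= r > s. Conversely b <= a + s gives
    sqrt(a b) <= a + s, so that 2 s < (E - 1) (a + s), which is s < R when
    E < 3. Finally R / r = (E + 1) / (3 - E). *)

Lemma tau_lt (R : realType) (X : metricType R) (p x y : X) (t : R) :
  x != p -> y != p ->
  (tau p x y < t) =
  (2 * mdist x y < (expR t - 1) * Num.sqrt (mdist x p * mdist y p)).
Proof.
rewrite -!mdist_gt0 => a_gt0 b_gt0.
have g_gt0 : 0 < Num.sqrt (mdist x p * mdist y p) by rewrite sqrtr_gt0 mulr_gt0.
have q_ge0 : 0 <= mdist x y / Num.sqrt (mdist x p * mdist y p).
  by rewrite divr_ge0 ?mdist_ge0 ?ltW.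
rewrite /tau -ltr_expR lnK; last by rewrite posrE; lra.
by rewrite -ltrBrDl mulrA ltr_pdivrMr.
Qed.

Lemma lt_sqrt_mul_of_lt_inner (R : rcfType) (E a b s : R) :
  1 <= E -> 0 < a -> a <= s + b -> s * (E + 1) < (E - 1) * a ->
  2 * a < Num.sqrt (a * b) * (E + 1).
Proof.
move=> E_ge1 a_gt0 a_le_sb s_lt.
have b_gt : 2 * a < b * (E + 1) by nra.
have b_gt0 : 0 < b by nra.
have ab_ge0 : 0 <= a * b by rewrite ltW ?mulr_gt0.
rewrite -(@ltr_pXn2r _ 2) ?nnegrE ?mulr_ge0 ?sqrtr_ge0//; try lra.
rewrite [ltRHS]exprMn sqr_sqrtr//.
(* After squaring, the claim is 4 a^2 < a b (E + 1)^2: scale [b_gt] by a, then use 2 <= E + 1. *)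
have ab_gt : a * (2 * a) < a * (b * (E + 1)) by rewrite ltr_pM2l.
nra.
Qed.

(** Both a and b are at most a + s, hence so is their geometric mean. *)
Lemma sqrt_mul_le_add (R : rcfType) (a b s : R) :
  0 <= a -> 0 <= s -> b <= a + s -> Num.sqrt (a * b) <= a + s.
Proof.
move=> a_ge0 s_ge0 b_le.
rewrite -(@ler_pXn2r _ 2) ?nnegrE ?addr_ge0 ?sqrtr_ge0//.
(* Here [b] may be negative; [Num.sqrt] sends a negative product to 0. *)
have [ab_ge0|ab_lt0] := lerP 0 (a * b); first by rewrite sqr_sqrtr//; nra.
by rewrite ltr0_sqrtr// expr0n sqr_ge0.
Qed.

Lemma ball_sub_tau_ball (R : realType) (X : metricType R) (p x : X) (t : R) :
  x != p -> 0 <= t -> ball x (inner_radius p x t) `<=` tau_ball p x t.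
Proof.
move=> xp t_ge0 y; rewrite ballEmdist /inner_radius /= mulrAC.
have E_ge1 : 1 <= expR t by rewrite -expR0 ler_expR.
rewrite ltr_pdivlMr; last lra.
move=> s_lt.
have a_gt0 : 0 < mdist x p by rewrite mdist_gt0.
have s_ge0 : 0 <= mdist x y by exact: mdist_ge0.
have tri : mdist x p <= mdist x y + mdist y p by exact: metric_triangle.
(* The inner radius is at most d(x,p), so the ball misses p. *)
have yp : y != p by rewrite -mdist_gt0; nra.
split=> //; rewrite tau_lt//.
(* The factor E - 1 vanishes at t = 0, so the strict inequality is inherited from [s_lt]. *)
have := lt_sqrt_mul_of_lt_inner E_ge1 a_gt0 tri s_lt.
nra.
Qed.

Lemma tau_ball_sub_ball (R : realType) (X : metricType R) (p x : X) (t : R) :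
  x != p -> 0 <= t < ln 3 -> tau_ball p x t `<=` ball x (outer_radius p x t).
Proof.
move=> xp /andP[t_ge0 t_lt] y [yp]; rewrite tau_lt// => s_lt.
have E_ge1 : 1 <= expR t by rewrite -expR0 ler_expR.
have E_lt3 : expR t < 3 by rewrite -[ltRHS]lnK ?posrE// ltr_expR.
rewrite ballEmdist /outer_radius /= mulrAC ltr_pdivlMr; last lra.
have tri : mdist y p <= mdist x p + mdist x y.
  by rewrite addrC (metric_sym x y) metric_triangle.
have := sqrt_mul_le_add (mdist_ge0 x p) (mdist_ge0 x y) tri.
nra.
Qed.

Lemma cvg_outer_radius_div_inner_radius (R : realType) (X : metricType R)
    (p x : X) :
  x != p ->
  outer_radius p x t / inner_radius p x t @[t --> (0 : R)^'+] --> (1 : R).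
Proof.
move=> xp.
have exp_cvg : expR t @[t --> (0 : R)^'+] --> (1 : R).
  apply: cvg_at_right_filter.
  by rewrite -[X in _ --> X](expR0 R); exact: continuous_expR.
have quot_cvg : (expR t + 1) / (3 - expR t) @[t --> (0 : R)^'+] --> (1 : R).
  rewrite [X in _ --> X](_ : 1 = (1 + 1) / (3 - 1)); last by field.
  apply: cvgM; first by apply: (cvgD exp_cvg); exact: cvg_cst.
  have two_neq0 : 3 - 1 != 0 :> R by rewrite gt_eqF//; lra.
  apply: (cvgV two_neq0).
  by apply: cvgB exp_cvg; exact: cvg_cst.
(* For t > 0 the factors E - 1 and d(x,p) are nonzero and cancel in R / r. *)
apply: cvg_trans quot_cvg; apply: near_eq_cvg; near=> t.
have t_gt0 : 0 < t by near: t; exact: nbhs_right_gt.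
have E_gt1 : 1 < expR t by rewrite -(expR0 R) ltr_expR.
have a_neq0 : mdist x p != 0 by rewrite gt_eqF ?mdist_gt0.
rewrite /outer_radius /inner_radius.
(* The identity holds for any value of the inverse, so no case t = ln 3, where
   the denominator vanishes, has to be excluded. *)
move: (3 - expR t)^-1 => u.
field.
by rewrite a_neq0 !gt_eqF//; lra.
Unshelve. all: by end_near. Qed.

Theorem theorem5p1 (R : realType) (X : metricType R) (p x : X) (hx : x != p) :
  (forall t : R, 0 <= t < ln 3 ->
     ball x (inner_radius p x t) `<=` tau_ball p x t /\
     tau_ball p x t `<=` ball x (outer_radius p x t)) /\
  outer_radius p x t / inner_radius p x t @[t --> (0 : R)^'+] --> (1 : R).
Proof.
split=> [t t_range|]; last exact: cvg_outer_radius_div_inner_radius.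
split; last exact: tau_ball_sub_ball.
by case/andP: t_range => t_ge0 _; exact: ball_sub_tau_ball.
Qed.
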